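(* Let $p$ be a prime. Let $a,b$ be integers with $1\le b\le a$, $\nu(a-b)=0$, and $\{\nu(a),\nu(b)\}=\{0,k\}$ for some integer $k\ge0$, and let $c,d\in\mathbb{Z}$ (possibly negative). Then the limit $\binom{ap^\infty+c}{bp^\infty+d}:=\lim_{e\to\infty}\binom{ap^e+c}{bp^e+d}$ exists in $\mathbb{Z}_p$ and $$\binom{ap^\infty+c}{bp^\infty+d}=\begin{cases}\binom{ap^\infty}{bp^\infty}\binom cd & c,d\ge0,\\[2pt] \binom{ap^\infty}{bp^\infty}\binom cd\frac{a-b}{a} & c<0\le d,\\[2pt] \binom{ap^\infty}{bp^\infty}\binom c{c-d}\frac ba & c<0\le c-d,\\[2pt] 0&\text{otherwise,}\end{cases}$$ where $\binom{ap^\infty}{bp^\infty}:=\lim_{e\to\infty}\binom{ap^e}{bp^e}$ (which exists in $\mathbb{Z}_p$).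
   Context: $\nu(n)$ denotes the exponent of the prime $p$ in a positive integer $n$. Limits are $p$-adic, in the metric $d(x,y)=p^{-\nu(x-y)}$ on $\mathbb{Z}_p$; the binomial coefficients $\binom{ap^e+c}{bp^e+d}$ are considered for $e$ large enough that $ap^e+c>0$ and $bp^e+d>0$. For $c\in\mathbb{Z}$ and an integer $d\ge0$, $\binom cd:=c(c-1)\cdots(c-d+1)/d!$. *)

(* Defs.v *)
From HB Require Import structures.
From mathcomp Require Import all_boot all_order all_algebra.
From mathcomp Require Import boolp classical_sets topology.

Set Implicit Arguments.
Unset Strict Implicit.
Unset Printing Implicit Defensive.

Import Order.TTheory GRing.Theory Num.Theory.
Local Open Scope ring_scope.

(* The p-adic valuation of an integer; None stands for nu(0) = +oo, whereas  *)
(* the library convention is logn p 0 = 0.                                   *)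
Definition nu (p : nat) (n : int) : option nat :=
  if n == 0 then None else Some (logn p `|n|%N).

(* c (c - 1) ... (c - d + 1) / d!, for c of any sign; the integer division   *)
(* is exact by binz_fact.                                                    *)
Definition binz (c : int) (d : nat) : int :=
  ((\prod_(i < d) (c - i%:Z)) %/ (d`!)%:Z)%Z.

Lemma prod_ffactz (n d : nat) : \prod_(i < d) (n%:Z - i%:Z) = (n ^_ d)%:Z.
Proof.
elim: d => [|d IHd]; first by rewrite big_ord0 ffactn0.
rewrite big_ord_recr /= IHd ffactnSr PoszM.
have [led|ltd] := leqP d n; first by rewrite subzn.
by rewrite ffact_small // !mul0r.
Qed.

Lemma prod_ffactNz (n d : nat) :
  \prod_(i < d) (- n.+1%:Z - i%:Z) = (-1) ^+ d * ((n + d) ^_ d)%:Z.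
Proof.
elim: d => [|d IHd]; first by rewrite big_ord0 expr0 mul1r ffactn0.
rewrite big_ord_recr /= IHd exprSr addnS ffactnS /= PoszM.
have -> : - n.+1%:Z - d%:Z = - (n + d).+1%:Z by rewrite -opprD -PoszD addSn.
by rewrite mulrN mulrN1 mulNr -!mulrA [X in _ * X]mulrC.
Qed.

Lemma binz_fact (c : int) (d : nat) :
  binz c d * (d`!)%:Z = \prod_(i < d) (c - i%:Z).
Proof.
apply/eqP; rewrite -dvdz_eq; case: c => n.
  by rewrite prod_ffactz -bin_ffact PoszM dvdz_mull.
by rewrite NegzE prod_ffactNz -bin_ffact PoszM mulrA dvdz_mull.
Qed.

Lemma binz_nat (n d : nat) : binz n%:Z d = 'C(n, d)%:Z.
Proof.
have d0 : (d`!)%:Z != 0 by rewrite eqz_nat -lt0n fact_gt0.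
by apply: (mulIf d0); rewrite binz_fact prod_ffactz -bin_ffact PoszM.
Qed.

(* Z_p as the inverse limit of the Z/p^n: x n is the representative of       *)
(* x mod p^n in [0, p^n).                                                    *)
Record padic_int (p : nat) (p_pr : prime p) := PadicInt {
  padic_res :> nat -> int;
  padic_resP : forall n, padic_res n = (padic_res n.+1 %% (p ^ n)%N%:Z)%Z
}.

HB.instance Definition _ (p : nat) (p_pr : prime p) :=
  gen_eqMixin (padic_int p_pr).
HB.instance Definition _ (p : nat) (p_pr : prime p) :=
  gen_choiceMixin (padic_int p_pr).

Section PadicRing.
Variables (p : nat) (p_pr : prime p).
Implicit Types x y z : padic_int p_pr.
Local Notation q n := ((p ^ n)%N%:Z).

Lemma padicP x y : (forall n, x n = y n) -> x = y.
Proof.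
case: x y => [u hu] [v hv] /= uv.
have {}uv : u = v by exact: funext.
by rewrite uv in hu *; rewrite (Prop_irrelevance hu hv).
Qed.

Lemma padic_modK x n : (x n %% q n)%Z = x n.
Proof. by rewrite padic_resP modz_mod. Qed.

Lemma q_dvd m n : (m <= n)%N -> (q m %| q n)%Z.
Proof. by move=> mn; rewrite dvdzE /= dvdn_exp2l. Qed.

Lemma modq_le (i : int) m n : (m <= n)%N -> ((i %% q n)%Z %% q m)%Z = (i %% q m)%Z.
Proof.
move=> /q_dvd /dvdzP[k ->]; apply/eqP; rewrite {2}(divz_eq i (k * q m)).
by rewrite mulrA modzMDl.
Qed.

Lemma padic_res_le x m n : (m <= n)%N -> (x n %% q m)%Z = x m.
Proof.
move=> /subnK <-; elim: (n - m)%N => [|j IHj]; first exact: padic_modK.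
by rewrite addSn -(modq_le (x (j + m).+1) (leq_addl j m)) -padic_resP.
Qed.

Lemma modz_eq0 (i j : int) : ((i %% j)%Z == 0) = (j %| i)%Z.
Proof. exact/eqP/dvdz_mod0P. Qed.

Lemma padic_mk_subproof (u : nat -> int) :
  (forall n, u n.+1 = u n %[mod q n])%Z ->
  forall n, (u n %% q n = (u n.+1 %% q n.+1)%Z %% q n)%Z.
Proof. by move=> hu n; rewrite modq_le // hu. Qed.

Definition padic_mk (u : nat -> int)
    (hu : (forall n, u n.+1 = u n %[mod q n])%Z) : padic_int p_pr :=
  PadicInt p_pr (padic_mk_subproof hu).

Lemma padic_const_subproof (i : int) :
  (forall n : nat, i = i %[mod q n])%Z.
Proof. by []. Qed.

Lemma padic_add_subproof x y :
  (forall n, x n.+1 + y n.+1 = x n + y n %[mod q n])%Z.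
Proof.
by move=> n; rewrite -modzDm -(padic_resP x) -(padic_resP y).
Qed.

Lemma padic_opp_subproof x :
  (forall n, - x n.+1 = - x n %[mod q n])%Z.
Proof. by move=> n; rewrite -modzNm -(padic_resP x). Qed.

Lemma padic_mul_subproof x y :
  (forall n, x n.+1 * y n.+1 = x n * y n %[mod q n])%Z.
Proof.
by move=> n; rewrite -modzMm -(padic_resP x) -(padic_resP y).
Qed.

Definition padic_const i := padic_mk (padic_const_subproof i).
Definition padic_add x y := padic_mk (padic_add_subproof x y).
Definition padic_opp x := padic_mk (padic_opp_subproof x).
Definition padic_mul x y := padic_mk (padic_mul_subproof x y).

Lemma padic_addA : associative padic_add.
Proof. by move=> x y z; apply: padicP => n /=; rewrite modzDml modzDmr addrA. Qed.

Lemma padic_addC : commutative padic_add.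
Proof. by move=> x y; apply: padicP => n /=; rewrite addrC. Qed.

Lemma padic_add0 : left_id (padic_const 0) padic_add.
Proof. by move=> x; apply: padicP => n /=; rewrite modzDml add0r padic_modK. Qed.

Lemma padic_addN : left_inverse (padic_const 0) padic_opp padic_add.
Proof. by move=> x; apply: padicP => n /=; rewrite modzDml addNr. Qed.

HB.instance Definition _ := GRing.isZmodule.Build (padic_int p_pr)
  padic_addA padic_addC padic_add0 padic_addN.

Lemma padic_mulA : associative padic_mul.
Proof. by move=> x y z; apply: padicP => n /=; rewrite modzMml modzMmr mulrA. Qed.

Lemma padic_mulC : commutative padic_mul.
Proof. by move=> x y; apply: padicP => n /=; rewrite mulrC. Qed.

Lemma padic_mul1 : left_id (padic_const 1) padic_mul.
Proof. by move=> x; apply: padicP => n /=; rewrite modzMml mul1r padic_modK. Qed.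

Lemma padic_mulD : left_distributive padic_mul padic_add.
Proof.
by move=> x y z; apply: padicP => n /=; rewrite modzMml modzDm mulrDl.
Qed.

Lemma padic_1neq0 : padic_const 1 != padic_const 0.
Proof.
apply/eqP => /(congr1 (fun x : padic_int p_pr => x 1%N)) /=.
by rewrite expn1 mod0z modz_small //= ltz_nat prime_gt1.
Qed.

HB.instance Definition _ := GRing.Zmodule_isComNzRing.Build (padic_int p_pr)
  padic_mulA padic_mulC padic_mul1 padic_mulD padic_1neq0.

Definition padic_unit x := `[< exists y, y * x = 1 >].
Definition padic_inv x :=
  if pselect (exists y, y * x = 1) is left xV then projT1 (cid xV) else x.

Lemma padic_mulVx : {in padic_unit, left_inverse 1 padic_inv *%R}.
Proof.
move=> x; rewrite -topredE /= => /asboolP xV; rewrite /padic_inv.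
by case: pselect => // {}xV; case: cid.
Qed.

Lemma padic_unitP x y : y * x = 1 -> padic_unit x.
Proof. by move=> yx; apply/asboolP; exists y. Qed.

Lemma padic_inv_out : {in [predC padic_unit], padic_inv =1 id}.
Proof.
by move=> x; rewrite inE -topredE /= => /asboolPn xV; rewrite /padic_inv; case: pselect.
Qed.

HB.instance Definition _ :=
  GRing.ComNzRing_hasMulInverse.Build (padic_int p_pr)
    padic_mulVx padic_unitP padic_inv_out.

Lemma padic_res0 n : (0 : padic_int p_pr) n = 0.
Proof. exact: mod0z. Qed.

Lemma padic_resM x y n : (x * y) n = (x n * y n %% q n)%Z.
Proof. by []. Qed.

Lemma padic_resB x y n : (x - y) n = ((x n - y n) %% q n)%Z.
Proof. by rewrite [LHS]/= modzDmr. Qed.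

Lemma padic_neq0P x : x != 0 -> exists n, x n != 0.
Proof.
move=> /eqP x0; apply: contrapT => nx; apply: x0; apply: padicP => n.
rewrite padic_res0; apply/eqP/negPn/negP => xn; apply: nx; by exists n.
Qed.

Lemma padic_res_neq0 x m n : x m != 0 -> (m <= n)%N ->
  x n != 0 /\ (logn p `|x n| < m)%N.
Proof.
move=> xm mn; have xn : x n != 0.
  by apply: contra_neq xm => xn; rewrite -(padic_res_le x mn) xn mod0z.
split=> //; rewrite ltnNge; apply: contra xm => le_m.
rewrite -(padic_res_le x mn) modz_eq0 dvdzE /=.
by rewrite pfactor_dvdn // absz_gt0.
Qed.

Lemma padic_idomain : GRing.integral_domain_axiom (padic_int p_pr).
Proof.
move=> x y xy0; apply: contrapT => /negP; rewrite negb_or => /andP[].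
move=> /padic_neq0P[m xm] /padic_neq0P[n yn].
have [xN lx] := padic_res_neq0 xm (leq_addr n m).
have [yN ly] := padic_res_neq0 yn (leq_addl m n).
have /eqP := congr1 (fun z : padic_int p_pr => z (m + n)%N) xy0.
rewrite padic_res0 padic_resM modz_eq0 dvdzE abszM /=.
rewrite pfactor_dvdn ?muln_gt0 ?absz_gt0 ?xN // lognM ?absz_gt0 //.
by rewrite leqNgt -addnS leq_add // ltnW.
Qed.

HB.instance Definition _ :=
  GRing.ComUnitRing_isIntegral.Build (padic_int p_pr) padic_idomain.

(* The largest n with x = 0 mod p^n, for x <> 0; the value at 0 is junk.     *)
Definition padic_val x : nat :=
  if pselect (exists n, x n.+1 != 0) is left ex then ex_minn ex else 0%N.

Lemma padic_valP x n : x != 0 -> (n <= padic_val x)%N = (x n == 0).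
Proof.
move=> x0; rewrite /padic_val; case: pselect => [ex|nex]; last first.
  case: nex; have [[|m] xm] := padic_neq0P x0; last by exists m.
  by move: xm; rewrite -padic_modK expn0 modz1 eqxx.
case: ex_minnP => m xm min_m.
have [nm|mn] := leqP n m; last first.
  by have [/negPf-> _] := padic_res_neq0 xm mn.
case: n nm => [|n nm]; first by rewrite -padic_modK expn0 modz1 eqxx.
by apply/esym/negPn/negP => /min_m; rewrite leqNgt nm.
Qed.

Lemma padic_res_int (i : int) n : (i%:~R : padic_int p_pr) n = (i %% q n)%Z.
Proof.
have nat_res (m : nat) : (m%:R : padic_int p_pr) n = (m%:Z %% q n)%Z.
  elim: m => [|m IHm]; first by rewrite mulr0n padic_res0 mod0z.
  rewrite -natr1 -[LHS]/(((m%:R : padic_int p_pr) n + (1 %% q n)%Z) %% q n)%Z.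
  by rewrite IHm modzDm -addn1 PoszD.
case: i => m; first exact: nat_res.
by rewrite NegzE mulrNz [LHS]/= nat_res modzNm.
Qed.

Lemma padic_int_inj : injective (fun i : int => i%:~R : padic_int p_pr).
Proof.
suff inj0 (i : int) : i%:~R = 0 :> padic_int p_pr -> i = 0.
  by move=> i j /= ij; apply/eqP; rewrite -subr_eq0; apply/eqP/inj0;
    rewrite rmorphB /= ij subrr.
move=> /(congr1 (fun z : padic_int p_pr => z `|i|%N)).
rewrite padic_res_int padic_res0 => /eqP.
rewrite modz_eq0 dvdzE /= => pi.
apply/eqP; rewrite -absz_eq0; apply: contraLR pi; rewrite -lt0n => i0.
by rewrite gtnNdvd // ltn_expl // prime_gt1.
Qed.

Lemma nu_padic_val (i : int) :
  i != 0 -> nu p i = Some (padic_val (i%:~R)).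
Proof.
move=> i0; rewrite /nu (negPf i0); congr Some.
have i0' : i%:~R != 0 :> padic_int p_pr.
  by apply: contra_neq i0 => iz; apply: padic_int_inj.
apply/eqP; rewrite eqn_leq padic_valP // -[X in _ && X]negbK -ltnNge.
have eqv n : ((i%:~R : padic_int p_pr) n == 0) = (n <= logn p `|i|)%N.
  rewrite padic_res_int modz_eq0 dvdzE /=.
  by rewrite pfactor_dvdn // absz_gt0.
by rewrite eqv leqnn /= -leqNgt -eqv -padic_valP.
Qed.

Definition padic_dist x y : rat :=
  if x == y then 0 else (p%:R ^+ padic_val (x - y))^-1.

Lemma padic_distxx x : padic_dist x x = 0.
Proof. by rewrite /padic_dist eqxx. Qed.

Lemma p_gt0 n : 0 < (p%:R : rat) ^+ n.
Proof. by rewrite exprn_gt0 // ltr0n prime_gt0. Qed.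

Lemma padic_dist_positivity x y : padic_dist x y = 0 -> x = y.
Proof.
rewrite /padic_dist; case: eqP => // _ /eqP.
by rewrite invr_eq0 gt_eqF ?p_gt0.
Qed.

Lemma padic_dist_le x y n :
  (padic_dist x y <= (p%:R ^+ n)^-1) = (x n == y n).
Proof.
rewrite /padic_dist; have [->|xy] := eqVneq x y.
  by rewrite invr_ge0 ltW ?p_gt0 // eqxx.
rewrite lef_pV2 ?posrE ?p_gt0 // ler_eXn2l ?ltr1n ?prime_gt1 //.
have xy0 : x - y != 0 by rewrite subr_eq0.
rewrite padic_valP // padic_resB modz_eq0.
by rewrite -eqz_mod_dvd !padic_modK.
Qed.

Lemma padic_dist_sym x y : padic_dist x y = padic_dist y x.
Proof.
wlog suff le_d : x y / padic_dist x y <= padic_dist y x.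
  by apply/eqP; rewrite eq_le !le_d.
rewrite {2}/padic_dist; have [->|xy] := eqVneq y x; first by rewrite padic_distxx.
have := lexx (padic_dist y x); rewrite {2}/padic_dist (negPf xy).
by rewrite !padic_dist_le eq_sym.
Qed.

Lemma padic_dist_triangle y x z :
  padic_dist x z <= padic_dist x y + padic_dist y z.
Proof.
have d_ge0 u v : 0 <= padic_dist u v.
  by rewrite /padic_dist; case: ifP => // _; rewrite invr_ge0 ltW ?p_gt0.
suff : (padic_dist x z <= padic_dist x y) || (padic_dist x z <= padic_dist y z).
  by case/orP => /le_trans; apply; rewrite ?lerDl ?lerDr.
have [<-|xy] := eqVneq x y; first by rewrite lexx orbT.
have [->|yz] := eqVneq y z; first by rewrite lexx.
have [dxy dyz] : padic_dist x y = (p%:R ^+ padic_val (x - y))^-1 /\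
                 padic_dist y z = (p%:R ^+ padic_val (y - z))^-1.
  by rewrite /padic_dist (negPf xy) (negPf yz).
move: (padic_val (x - y)) (padic_val (y - z)) dxy dyz => m n dxy dyz.
have /eqP xym : x m == y m by rewrite -padic_dist_le dxy.
have /eqP yzn : y n == z n by rewrite -padic_dist_le dyz.
rewrite dxy dyz !padic_dist_le; have [mn|/ltnW nm] := leqP m n.
  by rewrite xym -(padic_res_le y mn) yzn (padic_res_le z mn) eqxx.
by rewrite -(padic_res_le x nm) xym (padic_res_le y nm) yzn eqxx orbT.
Qed.

HB.instance Definition _ := isPointed.Build (padic_int p_pr) 0.

HB.instance Definition _ := isMetric.Build rat (padic_int p_pr)
  padic_distxx padic_dist_positivity padic_dist_sym padic_dist_triangle.

Lemma padic_cvgP (u : nat -> padic_int p_pr) x :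
  (u @ \oo --> x)%classic <->
  forall eps : rat, 0 < eps ->
    exists N, forall e, (N <= e)%N -> padic_dist x (u e) < eps.
Proof.
by split=> [/cvg_ballP cvu eps /cvu[N _ hN]|hu];
  [exists N | apply/cvg_ballP => eps /hu[N hN]; exists N].
Qed.

Lemma padic_cvg_res (u : nat -> padic_int p_pr) x :
  (u @ \oo --> x)%classic <->
  forall n, exists N, forall e, (N <= e)%N -> u e n = x n.
Proof.
rewrite padic_cvgP; split=> [hu n|hu eps eps0].
  have [|N hN] := hu (p%:R ^+ n)^-1; first by rewrite invr_gt0 p_gt0.
  by exists N => e /hN/ltW; rewrite padic_dist_le => /eqP.
have [n lt_n] : exists n, (p%:R ^+ n)^-1 < eps.
  have [m lt_m] : exists m : nat, eps^-1 < m%:R.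
    by exists (Num.bound eps^-1); rewrite archi_boundP // invr_ge0 ltW.
  exists m; rewrite -[eps]invrK ltf_pV2 ?posrE ?invr_gt0 ?p_gt0 //.
  by rewrite (lt_trans lt_m) // -natrX ltr_nat ltn_expl // prime_gt1.
have [N hN] := hu n; exists N => e /hN en.
by apply: le_lt_trans lt_n; rewrite padic_dist_le en.
Qed.

Lemma padic_hausdorff : hausdorff_space (padic_int p_pr).
Proof. exact: metric_hausdorff. Qed.

End PadicRing.

Notation padic p_pr := {fraction (padic_int p_pr)}.
Notation "x %:F" := (@FracField.tofrac _ x) : ring_scope.

Lemma padic_intr_eq0 (p : nat) (p_pr : prime p) (i : int) :
  (i%:~R == 0 :> padic p_pr) = (i == 0).
Proof.
rewrite -(rmorph_int (@FracField.tofrac (padic_int p_pr))) tofrac_eq0.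
by apply/eqP/eqP => [|->//]; apply: (padic_int_inj (p_pr := p_pr) (x2 := 0)).
Qed.

(* Only the e for which both a p^e + c and b p^e + d are positive matter     *)
(* below; for the others this is a junk value.                               *)
Definition binom_seq (p : nat) (p_pr : prime p) (a b c d : int) (e : nat)
    : padic_int p_pr :=
  (binz (a * p%:Z ^+ e + c) (absz (b * p%:Z ^+ e + d)))%:~R.

Definition binom_lim (p : nat) (p_pr : prime p) (a b c d : int)
    : padic_int p_pr :=
  lim (binom_seq p_pr a b c d @ \oo)%classic.

(* Main.v *)
Require Import Defs.
From mathcomp Require Import all_boot all_order all_algebra.
From mathcomp Require Import boolp classical_sets topology.
From mathcomp Require Import ring zify.
Import Order.TTheory GRing.Theory Num.Theory.
Local Open Scope classical_set_scope.
Local Open Scope ring_scope.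

(* Write A = a p^e and B = b p^e.  Raising (1 + X)^p = 1 + X^p mod p to       *)
(* successive p-th powers gives C(pA, pB) = C(A, B) mod p^(e+1), so C(A, B)   *)
(* is Cauchy, with limit L.  For d <> 0, (B + d) C(A, B + d) is a multiple of *)
(* A, so C(A, B + d) tends to 0, and Pascal's rule settles all c >= 0.  As    *)
(* a C(A - 1, B) = (a - b) C(A, B), the case c = -1, d = 0 converges to P     *)
(* with a P = (a - b) L, and C(A - 1, B - 1) tends to Q = L - P; Pascal's     *)
(* rule then gives c = -1, and the limit of                                   *)
(* (A + c + 1) C(A + c, B + d) = (A + c + 1 - B - d) C(A + c + 1, B + d)      *)
(* descends from c + 1 < 0 to c.                                              *)

(** The recurrences linking neighbours [(c, d)] have coefficients such as a p^e + c, which tend to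
    c, so the limits obey the recurrences of C(c, d) wherever the coefficient to be divided by has a
    nonzero limit ([padic_cvg_mulI]). [binom_seq00_cvg] gives the base point and [binom_seq0_cvg0]
    the rest of the row c = 0. Descending to c = -1 at d = 0, the coefficients a p^e and (a - b) p^e
    both tend to 0, but p^e cancels exactly ([binom_seqN10_cvg]): this is the source of (a - b)/a,
    and of b/a = 1 - (a - b)/a through Pascal's rule. [binom_seq_nonneg_cvg] and [binom_seq_neg_cvg]
    then fill the two half-planes. *)

(** Times d!, both sides are (c + 1) c ... (c + 1 - d), split at its first or its last factor. *)
Lemma mulr_binz_succ (c : int) (d : nat) :
  (c + 1) * binz c d = (c + 1 - d%:Z) * binz (c + 1) d.
Proof.
have d0 : (d`!)%:Z != 0 by rewrite eqz_nat -lt0n fact_gt0.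
apply: (mulIf d0); rewrite -!mulrA !binz_fact [RHS]mulrC.
transitivity (\prod_(i < d.+1) (c + 1 - i%:Z)); last by rewrite big_ord_recr.
rewrite big_ord_recl /= subr0; congr (_ * _).
by apply: eq_bigr => i _; rewrite /bump add1n; lia.
Qed.

Lemma mulr_binz_diag (c : int) (d : nat) :
  d.+1%:Z * binz (c + 1) d.+1 = (c + 1) * binz c d.
Proof.
have d0 : (d`!)%:Z != 0 by rewrite eqz_nat -lt0n fact_gt0.
apply: (mulIf d0); rewrite mulrAC -PoszM -factS mulrC -mulrA !binz_fact.
rewrite big_ord_recl /= subr0; congr (_ * _).
by apply: eq_bigr => i _; rewrite /bump add1n; lia.
Qed.

Lemma binz_pascal (c : int) (d : nat) :
  binz (c + 1) d.+1 = binz c d.+1 + binz c d.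
Proof.
have d0 : d.+1%:Z != 0 by [].
apply: (mulfI d0); rewrite mulrDr mulr_binz_diag.
(* Both sides equal c C(c - 1, d). *)
have -> : d.+1%:Z * binz c d.+1 = (c - d%:Z) * binz c d.
  have := mulr_binz_diag (c - 1) d; rewrite subrK => ->.
  by have := mulr_binz_succ (c - 1) d; rewrite subrK.
by rewrite -mulrDl; congr (_ * _); lia.
Qed.

Lemma binz0 (c : int) : binz c 0 = 1.
Proof. by rewrite /binz big_ord0 fact0. Qed.

(** * The congruence C(pA, pB) = C(A, B) *)

Lemma exprSD_order2 {R : comNzRingType} (x t : R) (n : nat) :
  exists s, (x + t) ^+ n.+1 = x ^+ n.+1 + n.+1%:R * x ^+ n * t + t ^+ 2 * s.
Proof.
elim: n => [|n [s IHn]]; first by exists 0; rewrite !expr1; ring.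
exists (n.+1%:R * x ^+ n + s * (x + t)); rewrite exprSr IHn !exprS.
by rewrite -(natr1 n.+1); ring.
Qed.

Lemma exprD_order1 {R : comNzRingType} (x t : R) (n : nat) :
  exists s, (x + t) ^+ n = x ^+ n + t * s.
Proof.
case: n => [|n]; first by exists 0; rewrite !expr0 mulr0 addr0.
have [s ->] := exprSD_order2 x t n.
by exists (n.+1%:R * x ^+ n + t * s); ring.
Qed.

Lemma exprD1_prime {R : comNzRingType} (x : R) (p : nat) : prime p ->
  exists s, (x + 1) ^+ p = x ^+ p + 1 + p%:R * s.
Proof.
case: p => // p p_pr; rewrite exprD1n big_ord_recl big_ord_recr /=.
rewrite expr0 /bump add1n binn bin0.
exists (\sum_(i < p) x ^+ i.+1 *+ ('C(p.+1, i.+1) %/ p.+1)).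
rewrite !mulr1n addrA addrAC addrC [1 + _]addrC [RHS]addrC mulr_sumr; congr (_ + _).
apply: eq_bigr => i _; rewrite mulr_natl -mulrnA add1n.
by rewrite divnK // prime_dvd_bin //= ltnS ltn_ord.
Qed.

(** Raising to the p-th power improves an error t = p^(e+1) s by one factor p: the linear term gains
    the coefficient p, and t^2 is divisible by p^(2e+2). *)
Lemma exprD1_prime_pow {R : comNzRingType} (x : R) (p e : nat) : prime p ->
  exists s, (x + 1) ^+ (p ^ e.+1) =
            (x ^+ p + 1) ^+ (p ^ e) + (p ^ e.+1)%:R * s.
Proof.
move=> p_pr; elim: e => [|e [s IHe]].
  by rewrite expn1 expr1; exact: exprD1_prime.
have [q def_p] : exists q, p = q.+1 by exists p.-1; rewrite prednK ?prime_gt0.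
have [u] := exprSD_order2 ((x ^+ p + 1) ^+ (p ^ e)) ((p ^ e.+1)%:R * s) q.
rewrite -def_p -(exprM _ (p ^ e) p) -expnSr => Eu.
rewrite (expnSr p e.+1) exprM IHe Eu.
exists (((x ^+ p + 1) ^+ (p ^ e)) ^+ q * s + (p ^ e)%:R * s ^+ 2 * u).
by rewrite !expnSr !natrM; ring.
Qed.

Lemma coef_exprXD1 {R : nzRingType} (n k : nat) :
  (('X + 1 : {poly R}) ^+ n)`_k = 'C(n, k)%:R.
Proof.
rewrite exprD1n coef_sum.
under eq_bigr => i _ do rewrite coefMn coefXn.
have [kn|nk] := ltnP k n.+1; last first.
  rewrite bin_small // big1 // => i _.
  by rewrite gtn_eqF ?mul0rn // (leq_trans _ nk).
rewrite (bigD1 (Ordinal kn)) //= eqxx big1 ?addr0 // => i.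
by rewrite -val_eqE /= eq_sym => /negPf->; rewrite mul0rn.
Qed.

(** Compare the coefficients of X^(b p^(e+1)) in (X + 1)^(a p^(e+1)) and (X^p + 1)^(a p^e); the
    latter is a polynomial in X^p. *)
Lemma bin_pow_prime_cong (p a b e : nat) : prime p ->
  ((p ^ e.+1)%N%:Z %|
     'C(a * p ^ e.+1, b * p ^ e.+1)%:Z - 'C(a * p ^ e, b * p ^ e)%:Z)%Z.
Proof.
move=> p_pr; have [s Es] := exprD1_prime_pow ('X : {poly int}) p e p_pr.
have [u Eu] := exprD_order1 (('X ^+ p + 1) ^+ (p ^ e)) ((p ^ e.+1)%:R * s) a.
rewrite -Es -!exprM in Eu.
have /(congr1 (fun f : {poly int} => f`_(b * p ^ e.+1))) := Eu.
rewrite coefD ![(_ * a)%N]mulnC coef_exprXD1.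
have -> : ('X^p + 1 : {poly int}) ^+ (a * p ^ e) =
          (('X + 1) ^+ (a * p ^ e)) \Po 'X^p.
  by rewrite rmorphXn /= comp_polyD comp_polyX comp_polyC.
rewrite coef_comp_poly_Xn ?prime_gt0 // expnSr !mulnA dvdn_mull // mulnK ?prime_gt0 //.
rewrite coef_exprXD1 -mulrA mulr_natl coefMn !natz => ->.
by rewrite addrC addKr -mulr_natl natz dvdz_mulr.
Qed.

(** * Limits and division in Z_p *)

Lemma padic_resD {p : nat} {p_pr : prime p} (x y : padic_int p_pr) (n : nat) :
  (x + y) n = ((x n + y n) %% (p ^ n)%N%:Z)%Z.
Proof. by []. Qed.

Lemma padic_cvg_eventually {p : nat} {p_pr : prime p}
    {u v : nat -> padic_int p_pr} {x : padic_int p_pr} :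
  (exists N, forall e, (N <= e)%N -> v e = u e) ->
  u @ \oo --> x -> v @ \oo --> x.
Proof.
move=> [M uv] /padic_cvg_res ux; apply/padic_cvg_res => n; have [N hN] := ux n.
exists (maxn M N) => e; rewrite geq_max => /andP[Me Ne].
by rewrite uv ?hN.
Qed.

Lemma padic_cvgD {p : nat} {p_pr : prime p}
    {u v : nat -> padic_int p_pr} {x y : padic_int p_pr} :
  u @ \oo --> x -> v @ \oo --> y -> (fun e => u e + v e) @ \oo --> x + y.
Proof.
move=> /padic_cvg_res ux /padic_cvg_res vy; apply/padic_cvg_res => n.
have [[M hM] [N hN]] := (ux n, vy n).
exists (maxn M N) => e; rewrite geq_max => /andP[Me Ne].
by rewrite !padic_resD hM ?hN.
Qed.

Lemma padic_cvgB {p : nat} {p_pr : prime p}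
    {u v : nat -> padic_int p_pr} {x y : padic_int p_pr} :
  u @ \oo --> x -> v @ \oo --> y -> (fun e => u e - v e) @ \oo --> x - y.
Proof.
move=> /padic_cvg_res ux /padic_cvg_res vy; apply/padic_cvg_res => n.
have [[M hM] [N hN]] := (ux n, vy n).
exists (maxn M N) => e; rewrite geq_max => /andP[Me Ne].
by rewrite !padic_resB hM ?hN.
Qed.

Lemma padic_cvgM {p : nat} {p_pr : prime p}
    {u v : nat -> padic_int p_pr} {x y : padic_int p_pr} :
  u @ \oo --> x -> v @ \oo --> y -> (fun e => u e * v e) @ \oo --> x * y.
Proof.
move=> /padic_cvg_res ux /padic_cvg_res vy; apply/padic_cvg_res => n.
have [[M hM] [N hN]] := (ux n, vy n).
exists (maxn M N) => e; rewrite geq_max => /andP[Me Ne].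
by rewrite !padic_resM hM ?hN.
Qed.

Lemma padic_cvg_cst {p : nat} {p_pr : prime p} (x : padic_int p_pr) :
  (fun _ : nat => x) @ \oo --> x.
Proof. by apply/padic_cvg_res => n; exists 0%N. Qed.

(* Z_p is bounded, so that the second factor need not converge. *)
Lemma padic_cvg0M {p : nat} {p_pr : prime p} {u : nat -> padic_int p_pr}
    (v : nat -> padic_int p_pr) :
  u @ \oo --> (0 : padic_int p_pr) ->
  (fun e => u e * v e) @ \oo --> (0 : padic_int p_pr).
Proof.
move=> /padic_cvg_res u0; apply/padic_cvg_res => n; have [N hN] := u0 n.
by exists N => e /hN; rewrite padic_resM !padic_res0 => ->; rewrite mul0r mod0z.
Qed.

(** The valuation of [w] is below [m], so cancelling [w] costs at most [m] digits of precision. *)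
Lemma padic_res_mul_eq0 {p : nat} {p_pr : prime p} {w z : padic_int p_pr}
    {m n : nat} :
  w m != 0 -> (w * z) (m + n)%N = 0 -> z n = 0.
Proof.
move=> wm /eqP wz.
have [wN lw] := padic_res_neq0 wm (leq_addr n m).
apply/eqP; rewrite -(padic_res_le z (leq_addl m n)).
have [-> | zN] := eqVneq (z (m + n)%N) 0; first by rewrite mod0z.
move: wz; rewrite padic_resM !modz_eq0 !dvdzE abszM /=.
rewrite !pfactor_dvdn ?muln_gt0 ?absz_gt0 ?wN // lognM ?absz_gt0 //.
by lia.
Qed.

Lemma padic_cvg_mulI {p : nat} {p_pr : prime p}
    {w u : nat -> padic_int p_pr} {y x : padic_int p_pr} : y != 0 ->
  w @ \oo --> y -> (fun e => w e * u e) @ \oo --> y * x -> u @ \oo --> x.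
Proof.
move=> y0 wy wu.
(* y (u - x) = (y - w) u + (w u - y x), where u is bounded. *)
have d0 : (fun e => y * (u e - x)) @ \oo --> (0 : padic_int p_pr).
  have yw := padic_cvgB (padic_cvg_cst y) wy; rewrite subrr in yw.
  have := padic_cvgD (padic_cvg0M u yw)
    (padic_cvgB wu (padic_cvg_cst (y * x))).
  rewrite subrr addr0; apply: padic_cvg_eventually; exists 0%N => e _; ring.
have [m ym] := padic_neq0P y0.
apply/padic_cvg_res => n; move/padic_cvg_res: d0 => /(_ (m + n)%N)[N hN].
exists N => e /hN; rewrite padic_res0 => /(padic_res_mul_eq0 ym) /eqP.
by rewrite padic_resB modz_eq0 -eqz_mod_dvd !padic_modK => /eqP.
Qed.

Lemma padic_cauchy_cvg {p : nat} {p_pr : prime p} {u : nat -> padic_int p_pr} :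
  (forall n, exists N, forall e, (N <= e)%N -> u e n = u N n) ->
  exists x : padic_int p_pr, u @ \oo --> x.
Proof.
move=> /choice[N hN].
have compat n : (u (N n.+1) n.+1 = u (N n) n %[mod (p ^ n)%N%:Z])%Z.
  rewrite -padic_resP padic_modK.
  (* [N] need not be monotone, so both residues are compared at the larger index. *)
  rewrite -(hN n _ (leq_maxr (N n.+1) (N n))).
  by rewrite [LHS]padic_resP [RHS]padic_resP (hN n.+1 (maxn _ _)) ?leq_maxl.
exists (padic_mk p_pr compat); apply/padic_cvg_res => n.
by exists (N n) => e /hN -> /=; rewrite padic_modK.
Qed.

(** [y] may be a non-unit, so z / y is not known in advance to lie in Z_p; instead [u] is shown to
    be Cauchy. *)
Lemma padic_cvg_mulI_exists {p : nat} {p_pr : prime p}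
    {u : nat -> padic_int p_pr} {y z : padic_int p_pr} :
  y != 0 -> (fun e => y * u e) @ \oo --> z ->
  exists2 x : padic_int p_pr, u @ \oo --> x & y * x = z.
Proof.
move=> y0 yu; suff [x ux] : exists x : padic_int p_pr, u @ \oo --> x.
  exists x => //; have yx := padic_cvgM (padic_cvg_cst y) ux.
  exact: cvg_unique (padic_hausdorff (p_pr := p_pr)) _ _ _ _ yx yu.
have [m ym] := padic_neq0P y0.
apply: padic_cauchy_cvg => n; move/padic_cvg_res: yu => /(_ (m + n)%N)[N hN].
exists N => e Ne; apply/eqP; rewrite -(padic_modK (u e)) -(padic_modK (u N)).
rewrite eqz_mod_dvd -modz_eq0 -padic_resB; apply/eqP.
apply: (padic_res_mul_eq0 ym); rewrite mulrBr padic_resB.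
by rewrite !hN // subrr mod0z.
Qed.

Lemma padic_cvg_affine {p : nat} (p_pr : prime p) (a c : int) :
  (fun e => (a * p%:Z ^+ e + c)%:~R) @ \oo --> (c%:~R : padic_int p_pr).
Proof.
apply/padic_cvg_res => n; exists n => e /subnK <-.
rewrite !padic_res_int exprD mulrA.
by rewrite -[p%:Z]natz -!natrX !natz modzMDl.
Qed.

(** * Recurrences along the sequences, and the half-plane c >= 0 *)

(** Since p^e > e, this makes the absolute value in [binom_seq] harmless for large [e]. *)
Lemma mulrXp_addr_ge0 {p : nat} {b d : int} {e : nat} :
  prime p -> 1 <= b -> (`|d| <= e)%N -> 0 <= b * p%:Z ^+ e + d.
Proof.
move=> p_pr b1 de; rewrite -[p%:Z]natz -natrX natz.
have := ltn_expl e (prime_gt1 p_pr); move: (p ^ e)%N => P; nia.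
Qed.

Lemma binom_seq_pascal {p : nat} (p_pr : prime p) (a : int) {b : int} (c d : int) :
  1 <= b -> exists N, forall e, (N <= e)%N ->
    binom_seq p_pr a b (c + 1) (d + 1) e =
    binom_seq p_pr a b c (d + 1) e + binom_seq p_pr a b c d e.
Proof.
move=> b1; exists `|d|%N => e /(mulrXp_addr_ge0 p_pr b1).
rewrite /binom_seq -intrD !addrA; case: (b * _ + d) => // D _.
by rewrite -PoszD !absz_nat addn1 binz_pascal.
Qed.

Lemma binom_seq_diag {p : nat} (p_pr : prime p) (a : int) {b : int} (c d : int) :
  1 <= b -> exists N, forall e, (N <= e)%N ->
    (b * p%:Z ^+ e + (d + 1))%:~R * binom_seq p_pr a b (c + 1) (d + 1) e =
    (a * p%:Z ^+ e + (c + 1))%:~R * binom_seq p_pr a b c d e.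
Proof.
move=> b1; exists `|d|%N => e /(mulrXp_addr_ge0 p_pr b1).
rewrite /binom_seq -!intrM !addrA; case: (b * _ + d) => // D _.
by rewrite -PoszD !absz_nat addn1 mulr_binz_diag.
Qed.

Lemma binom_seq_succ {p : nat} (p_pr : prime p) (a : int) {b : int} (c d : int) :
  1 <= b -> exists N, forall e, (N <= e)%N ->
    (a * p%:Z ^+ e + (c + 1))%:~R * binom_seq p_pr a b c d e =
    ((a - b) * p%:Z ^+ e + (c + 1 - d))%:~R * binom_seq p_pr a b (c + 1) d e.
Proof.
move=> b1; exists `|d|%N => e /(mulrXp_addr_ge0 p_pr b1) /gez0_abs De.
rewrite /binom_seq -!intrM addrA mulr_binz_succ De; congr (_ * _)%:~R.
by ring.
Qed.

Lemma binom_seq00_cvg {p : nat} (p_pr : prime p) (a b : nat) :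
  exists x : padic_int p_pr, binom_seq p_pr a%:Z b%:Z 0 0 @ \oo --> x.
Proof.
have E e : binom_seq p_pr a%:Z b%:Z 0 0 e = ('C(a * p ^ e, b * p ^ e)%:Z)%:~R.
  rewrite /binom_seq !addr0 -[p%:Z]natz -natrX natz -!PoszM absz_nat.
  by rewrite binz_nat.
apply: padic_cauchy_cvg => n; exists n => e /subnK <-.
elim: (e - n)%N => // j <-; rewrite !E !padic_res_int addSn; apply/eqP.
rewrite eqz_mod_dvd; apply: dvdz_trans (bin_pow_prime_cong _ _ _ _ p_pr).
by apply: q_dvd; lia.
Qed.

Lemma binom_seq0_cvg0 {p : nat} (p_pr : prime p) (a : int) {b d : int} :
  1 <= b -> d != 0 ->
  binom_seq p_pr a b 0 d @ \oo --> (0 : padic_int p_pr).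
Proof.
move=> b1 d0; have d0' : d%:~R != 0 :> padic_int p_pr.
  by apply: contra_neq d0 => /(padic_int_inj (x2 := 0)).
apply: (padic_cvg_mulI d0' (padic_cvg_affine p_pr b d)); rewrite mulr0.
(* (B + d) C(A, B + d) = A C(A - 1, B + d - 1), with A tending to 0. *)
have := padic_cvg0M (binom_seq p_pr a b (-1) (d - 1)) (padic_cvg_affine p_pr a 0).
by apply: padic_cvg_eventually; have := binom_seq_diag p_pr a (-1) (d - 1) b1;
  rewrite subrK addNr.
Qed.

Lemma binom_seq_nonneg_cvg {p : nat} {p_pr : prime p} {a b : int}
    {L : padic_int p_pr} : 1 <= b -> binom_seq p_pr a b 0 0 @ \oo --> L ->
  forall (c : nat) (d : int), binom_seq p_pr a b c d @ \oo -->
    (if 0 <= d then (binz c `|d|%N)%:~R * L else 0).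
Proof.
move=> b1 limL; elim=> [|c IHc] d.
  have [->|d0] := eqVneq d 0; first by rewrite binz0 mul1r.
  case: ifP => [|_]; last exact: binom_seq0_cvg0.
  case: d d0 => // [[//|d]] _ _; rewrite binz_nat bin0n mul0r.
  exact: binom_seq0_cvg0.
have := binom_seq_pascal p_pr a c (d - 1) b1; rewrite subrK -PoszD addn1.
move=> /padic_cvg_eventually/(_ (padic_cvgD (IHc d) (IHc (d - 1)))).
congr (_ --> _); case: d => [[|d]|d]; last by rewrite /= addr0.
  by rewrite /= !binz0 addr0.
have -> : d.+1%:Z - 1 = d by lia.
by rewrite /= -mulrDl -intrD -binz_pascal -PoszD addn1.
Qed.

(* The limit for c < 0 when P and Q are the limits for (c, d) = (-1, 0) and   *)
(* (-1, -1).                                                                  *)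
Definition neg_binom_lim {p : nat} {p_pr : prime p} (P Q : padic_int p_pr)
    (c d : int) : padic_int p_pr :=
  if 0 <= d then (binz c `|d|%N)%:~R * P
  else if 0 <= c - d then (binz c `|(c - d)%R|%N)%:~R * Q else 0.

(** * The half-plane c < 0 *)

Lemma neg_binom_lim_succ {p : nat} {p_pr : prime p} (P Q : padic_int p_pr)
    (c d : int) : c + 1 < 0 ->
  (c + 1)%:~R * neg_binom_lim P Q c d =
  (c + 1 - d)%:~R * neg_binom_lim P Q (c + 1) d.
Proof.
move=> c0; rewrite /neg_binom_lim; case: ifP => [d0|d0].
  by rewrite !mulrA -!intrM mulr_binz_succ gez0_abs.
have -> : c + 1 - d = c - d + 1 by ring.
case: ifP => [cd|cd].
  have -> : 0 <= c - d + 1 by lia.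
  rewrite !mulrA -!intrM; case: (c - d) cd => // m _.
  by rewrite -PoszD addn1 !absz_nat mulr_binz_diag.
rewrite mulr0; case: ifP => cd1; last by rewrite mulr0.
(* On the edge of the zero region the coefficient c + 1 - d vanishes. *)
have -> : c - d + 1 = 0 by lia.
by rewrite mul0r.
Qed.

Lemma binzN1S (d : nat) : binz (-1) d.+1 = - binz (-1) d.
Proof.
have := binz_pascal (-1) d; rewrite addNr (binz_nat 0) bin0n => /esym/eqP.
by rewrite addr_eq0 => /eqP.
Qed.

(** By Pascal's rule and the vanishing limits on the row c = 0, neighbouring limits are opposite,
    except between d = -1 and d = 0. Hence the two seeds, [P] propagating upwards and [Q]
    downwards. *)
Lemma binom_seqN1_cvg {p : nat} {p_pr : prime p} {a b : int}
    {P Q : padic_int p_pr} : 1 <= b ->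
  binom_seq p_pr a b (-1) 0 @ \oo --> P ->
  binom_seq p_pr a b (-1) (-1) @ \oo --> Q ->
  forall d, binom_seq p_pr a b (-1) d @ \oo --> neg_binom_lim P Q (-1) d.
Proof.
move=> b1 limP limQ.
have pascal d := binom_seq_pascal p_pr a (-1) d b1.
rewrite /neg_binom_lim; case=> d; last rewrite NegzE.
  rewrite /=; elim: d => [|d IHd]; first by rewrite binz0 mul1r.
  have /padic_cvgB/(_ IHd) := binom_seq0_cvg0 p_pr a b1 (isT : d.+1%:Z != 0).
  rewrite binzN1S sub0r mulrNz mulNr.
  apply: padic_cvg_eventually; have [N hN] := pascal d; exists N => e /hN.
  by rewrite addNr -PoszD addn1 => ->; rewrite addrK.
have -> : (0 <= - d.+1%:Z) = false by lia.
have -> : -1 - - d.+1%:Z = d by lia.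
rewrite /=; elim: d => [|d IHd]; first by rewrite binz0 mul1r.
have /padic_cvgB/(_ IHd) := binom_seq0_cvg0 p_pr a b1 (isT : - d.+1%:Z != 0).
rewrite binzN1S sub0r mulrNz mulNr.
apply: padic_cvg_eventually; have [N hN] := pascal (- d.+2%:Z).
exists N => e /hN; rewrite addNr.
have -> : - d.+2%:Z + 1 = - d.+1%:Z by lia.
by move=> ->; rewrite addrC addKr.
Qed.

Lemma binom_seq_neg_cvg {p : nat} {p_pr : prime p} {a b : int}
    {P Q : padic_int p_pr} : 1 <= b ->
  binom_seq p_pr a b (-1) 0 @ \oo --> P ->
  binom_seq p_pr a b (-1) (-1) @ \oo --> Q ->
  forall (n : nat) (d : int),
  binom_seq p_pr a b (- n.+1%:Z) d @ \oo --> neg_binom_lim P Q (- n.+1%:Z) d.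
Proof.
move=> b1 limP limQ; elim=> [|n IHn] d; first exact: binom_seqN1_cvg.
have Ec : - n.+2%:Z + 1 = - n.+1%:Z by lia.
have n0 : (- n.+1%:Z)%:~R != 0 :> padic_int p_pr.
  by apply/eqP => /(padic_int_inj (x2 := 0)).
apply: (padic_cvg_mulI n0 (padic_cvg_affine p_pr a (- n.+1%:Z))).
have := neg_binom_lim_succ P Q (- n.+2%:Z) d; rewrite Ec => -> //.
apply: padic_cvg_eventually
  (padic_cvgM (padic_cvg_affine p_pr (a - b) (- n.+1%:Z - d)) (IHn d)).
by have := binom_seq_succ p_pr a (- n.+2%:Z) d b1; rewrite Ec.
Qed.

Lemma binom_seqN10_cvg {p : nat} {p_pr : prime p} {a b : int}
    {L : padic_int p_pr} : 1 <= b -> a != 0 ->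
  binom_seq p_pr a b 0 0 @ \oo --> L ->
  exists2 P : padic_int p_pr, binom_seq p_pr a b (-1) 0 @ \oo --> P &
    a%:~R * P = (a - b)%:~R * L.
Proof.
move=> b1 a0 limL.
apply: padic_cvg_mulI_exists.
  by apply: contra_neq a0 => /(padic_int_inj (x2 := 0)).
apply: padic_cvg_eventually (padic_cvgM (padic_cvg_cst _) limL).
have [N hN] := binom_seq_succ p_pr a (-1) 0 b1; exists N => e /hN.
rewrite addNr subr0 !addr0 ![(_ * p%:Z ^+ e)%:~R]intrM ![_ * (p%:Z ^+ e)%:~R]mulrC.
(* The common factor p^e is cancelled at each finite [e], before the limit. *)
rewrite -!mulrA; apply: mulfI; apply/eqP => /(padic_int_inj (x2 := 0)) /eqP.
by rewrite expf_eq0 eqz_nat eqn0Ngt (prime_gt0 p_pr) andbF.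
Qed.

Theorem theorem1p5 (p : nat) (p_pr : prime p) (a b c d : int) (k : nat)
    (b_ge1 : 1 <= b) (le_ba : b <= a)
    (nu_ab : nu p (a - b) = Some 0%N)
    (nu_a_b : [set nu p a; nu p b] = [set Some 0%N; Some k]) :
  [/\ cvg (binom_seq p_pr a b 0 0 @ \oo),
      cvg (binom_seq p_pr a b c d @ \oo) &
      (binom_lim p_pr a b c d)%:F =
        if (0 <= c) && (0 <= d) then
          (binom_lim p_pr a b 0 0)%:F * (binz c (absz d))%:~R
        else if (c < 0) && (0 <= d) then
          (binom_lim p_pr a b 0 0)%:F * (binz c (absz d))%:~R
            * ((a - b)%:~R / a%:~R)
        else if (c < 0) && (0 <= c - d) then
          (binom_lim p_pr a b 0 0)%:F * (binz c (absz (c - d)%R))%:~R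
            * (b%:~R / a%:~R)
        else 0 :> padic p_pr].
Proof.
have a0 : a != 0 by lia.
have [L limL] : exists x : padic_int p_pr, binom_seq p_pr a b 0 0 @ \oo --> x.
  have [-> ->] : a = `|a|%N /\ b = `|b|%N by lia.
  exact: binom_seq00_cvg.
have [P limP aP] := binom_seqN10_cvg b_ge1 a0 limL.
have limQ : binom_seq p_pr a b (-1) (-1) @ \oo --> L - P.
  apply: padic_cvg_eventually (padic_cvgB limL limP).
  have [N hN] := binom_seq_pascal p_pr a (-1) (-1) b_ge1; exists N => e /hN.
  by rewrite addNr => ->; rewrite addrC addKr.
have limE c' d' x : binom_seq p_pr a b c' d' @ \oo --> x ->
    binom_lim p_pr a b c' d' = x.
  by move=> ?; apply: cvg_lim => //; exact: padic_hausdorff.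
have aF0 : a%:~R != 0 :> padic p_pr by rewrite padic_intr_eq0.
have F_int (i : int) : i%:~R = (i%:~R : padic_int p_pr)%:F by rewrite rmorph_int.
have quotF (x : padic_int p_pr) (i : int) : a%:~R * x = i%:~R * L ->
    x%:F = L%:F * (i%:~R / a%:~R).
  move=> ax; apply: (mulfI aF0); rewrite [RHS]mulrC -mulrA divfK // !F_int.
  by rewrite -!rmorphM /= ax mulrC.
have PF := quotF _ _ aP.
(* a (L - P) = a L - (a - b) L = b L. *)
have QF : (L - P)%:F = L%:F * (b%:~R / a%:~R).
  apply: quotF; rewrite mulrBr aP -mulrBl -intrB.
  by congr (_%:~R * _); lia.
rewrite (limE _ _ _ limL).
suff [x cvgx Ex] : exists2 x : padic_int p_pr,
    binom_seq p_pr a b c d @ \oo --> x & x%:F =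
        if (0 <= c) && (0 <= d) then L%:F * (binz c (absz d))%:~R
        else if (c < 0) && (0 <= d) then L%:F * (binz c (absz d))%:~R
            * ((a - b)%:~R / a%:~R)
        else if (c < 0) && (0 <= c - d) then
          L%:F * (binz c (absz (c - d)%R))%:~R * (b%:~R / a%:~R)
        else 0 :> padic p_pr.
  by split; [apply: cvgP limL | apply: cvgP cvgx | rewrite (limE _ _ _ cvgx)].
case: c => n; last rewrite NegzE.
  exists (if 0 <= d then (binz n `|d|%N)%:~R * L else 0).
    exact: binom_seq_nonneg_cvg.
  by rewrite /=; case: ifP => _; rewrite ?rmorph0 // mulrC rmorphM /= F_int.
exists (neg_binom_lim P (L - P) (- n.+1%:Z) d); first exact: binom_seq_neg_cvg.
rewrite /neg_binom_lim /=; case: ifP => _.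
  by rewrite rmorphM /= PF F_int mulrCA mulrA.
by case: ifP => _; rewrite ?rmorph0 // rmorphM /= QF F_int mulrCA mulrA.
Qed.
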